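(* Let $R:\mathbb N\cup\{\infty\}\to\mathbb R_+$ be any non-increasing reward function (with $R(\infty)=0$). Then $$\sup_{A^\infty}\mathbb E_{\pi_1^\otimes}\bigl[R(\tau^{A^\infty})\bigr]=\sup_{a^\infty\text{ Markov}}\mathbb E_{\pi_1^\otimes}\bigl[R(\tau^{a^\infty})\bigr],$$ where the supremum on the left is over all policies $A^\infty$ and the supremum on the right is over all Markov policies $a^\infty$.
   Context: Notation: $\mathbb N=\{0,1,2,\dots\}$, $\mathbb R_+=[0,\infty)$, $\inf\emptyset=\infty$. For a sequence $x_1,x_2,\dots$, $x^t=(x_1,\dots,x_t)$ ($x^0$ is the empty history) and $x^\infty$ is the full sequence. $\mathcal X$ is a standard Borel space, $\mathcal P_{\mathcal X}$ is the set of Borel probability measures on $\mathcal X$, $\mathcal P_0\subseteq\mathcal P_{\mathcal X}$ (the null hypothesis) and $\pi_1\in\mathcal P_{\mathcal X}\setminus\mathcal P_0$ (the simple alternative) are fixed. For $\pi\in\mathcal P_{\mathcal X}$, $\pi^\otimes$ is the infinite product measure on $\mathcal X^\infty$. A level $\alpha\in(0,1)$ is fixed. Action space: $\mathcal A$ is a standard Borel space and $\phi:\mathcal A\times\mathcal X\to\mathbb R_+$ is a (jointly) Borel map satisfying $\int_{\mathcal X}\phi(a,x)\,\mathrm d\pi(x)\le 1$ for every $a\in\mathcal A$ and every $\pi\in\mathcal P_0$. A policy is a sequence $A^\infty=(A_t)_{t\ge1}$ of Borel maps $A_t:\mathcal X^{t-1}\to\mathcal A$. Its wealth process is defined by $\widehat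 W_0^{A^\infty}=1$ and $\widehat W_t^{A^\infty}(x^t)=\widehat W_{t-1}^{A^\infty}(x^{t-1})\,\phi(A_t(x^{t-1}),x_t)$, and its rejection time is $\tau^{A^\infty}(x^\infty)=\inf\{t\ge1:\widehat W_t^{A^\infty}(x^t)\ge\alpha^{-1}\}$. A Markov policy is a sequence $a^\infty=(a_t)_{t\ge0}$ of Borel maps $a_t:[0,\alpha^{-1})\to\mathcal A$. It is identified with any policy which, after $t$ rounds have been played with current wealth $w<\alpha^{-1}$, chooses the action $a_t(w)$ for the bet on $x_{t+1}$ (the action chosen once the wealth has reached $\alpha^{-1}$ is irrelevant). Thus the wealth starts from $1$ and evolves, until it first reaches $\alpha^{-1}$, by $W_{t+1}=W_t\,\phi(a_t(W_t),x_{t+1})$; $\tau^{a^\infty}$ is the first $t\ge1$ with $W_t\ge\alpha^{-1}$ ($\infty$ if there is none). A reward function is a non-increasing map $R:\mathbb N\cup\{\infty\}\to\mathbb R_+$ with $R(\infty)=0$. *)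

(* Defs.v *)
From HB Require Import structures.
From mathcomp Require Import all_boot all_order all_algebra.
From mathcomp Require Import all_classical all_reals all_analysis.

Set Implicit Arguments.
Unset Strict Implicit.
Unset Printing Implicit Defensive.

Import Order.TTheory GRing.Theory Num.Theory.
Import numFieldNormedType.Exports.

Local Open Scope classical_set_scope.
Local Open Scope ring_scope.

Definition polish (R : realType) (M : metricType R) : Prop :=
  (forall F : set_system M, ProperFilter F -> cauchy F ->
     exists l : M, F --> l) /\
  (exists2 D : set M, countable D & dense D).

(* T is Borel isomorphic to a Polish space; <<s open >> is its Borel
   sigma-algebra. A measurableType is pointed, hence nonempty. *)
Definition standard_borel (R : realType) (d : measure_display)
    (T : measurableType d) : Prop :=
  exists (M : metricType R) (f : T -> M),
    [/\ polish M, bijective f &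
        forall B : set M, <<s @open M >> B <-> measurable (f @^-1` B)].

(* The space of sequences x_1, x_2, ... with the product sigma-algebra.
   Indices are shifted: x t stands for x_{t+1}. *)
Definition coordinate_sets (d : measure_display) (X : measurableType d) :
    set_system (nat -> X) :=
  \bigcup_i preimage_set_system setT (fun x : nat -> X => x i) measurable.

Definition seq_space (d : measure_display) (X : measurableType d) :=
  g_sigma_algebraType (@coordinate_sets d X).

(* The defining property of the infinite product measure; by the pi-lambda
   theorem it determines P on the product sigma-algebra. *)
Definition infinite_product (R : realType) (d : measure_display)
    (X : measurableType d) (pi : probability X R)
    (P : probability (seq_space X) R) : Prop :=
  forall (n : nat) (B : nat -> set X), (forall i, measurable (B i)) ->
    P [set x : nat -> X | forall i, (i < n)%N -> B i (x i)] =
    (\prod_(i < n) pi (B i))%E.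

(* N together with infinity, the latter being None. *)
Definition enat := option nat.

Definition enat_le (s t : enat) : bool :=
  match s, t with
  | _, None => true
  | None, Some _ => false
  | Some m, Some n => (m <= n)%N
  end.

Definition reward_function (R : realType) (rew : enat -> R) : Prop :=
  [/\ forall s, 0 <= rew s,
      forall s t, enat_le s t -> rew t <= rew s
    & rew None = 0].

Definition rejection_time (R : realType) (alpha : R) (W : nat -> R) : enat :=
  match pselect (exists t, (0 < t)%N && (alpha^-1 <= W t)) with
  | left h => Some (ex_minn h)
  | right _ => None
  end.

Section policies.
Context (R : realType) (dX dA : measure_display)
  (X : measurableType dX) (A : measurableType dA)
  (phi : A * X -> R) (alpha : R).

Definition prefix (x : nat -> X) (t : nat) : t.-tuple X := [tuple x i | i < t].

(* pol t is the action A_{t+1}, a function of the first t observations. *)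
Definition is_policy (pol : forall t : nat, t.-tuple X -> A) : Prop :=
  forall t, measurable_fun setT (pol t).

Fixpoint wealth (pol : forall t : nat, t.-tuple X -> A) (x : nat -> X)
    (t : nat) : R :=
  if t is s.+1 then wealth pol x s * phi (pol s (prefix x s), x s) else 1.

(* A Borel map [0, alpha^-1) -> A is represented by a function on R that is
   measurable on [0, alpha^-1); its values elsewhere are never used. *)
Definition is_markov_policy (a : nat -> R -> A) : Prop :=
  forall t, measurable_fun `[0, alpha^-1[%classic (a t).

(* The process is frozen once it has reached alpha^-1. *)
Fixpoint markov_wealth (a : nat -> R -> A) (x : nat -> X) (t : nat) : R :=
  if t is s.+1 then
    let w := markov_wealth a x s in
    if w < alpha^-1 then w * phi (a s w, x s) else w
  else 1.

End policies.

(* Main.v *)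
From HB Require Import structures.
From Pilot Require Import Defs.
From mathcomp Require Import all_boot all_order all_algebra.
From mathcomp Require Import all_classical all_reals all_analysis.
From mathcomp Require Import measurable_realfun.

(* Fix a policy and truncate its reward at a finite horizon, which costs nothing
   by monotone convergence. Going backwards in time, the action at time [t] is
   replaced by a function of the current wealth: with a Markov continuation, the
   conditional value given the past depends only on the wealth [w] and on the
   action [a], as [Q(w, a)]. Under the joint law [mu] of wealth and action, each
   superlevel set of [Q] is filled up to small [mu]-measure by a set which is
   compact in the action variable; such a set has a Borel projection to the wealth
   and a Borel selector over it. Choosing, at each wealth, the selector of the
   highest available level gives a Borel [s] with [Q(w, s w) >= Q(w, a) - e]
   outside a set of pairs of small measure, so every step loses arbitrarily
   little. No universally measurable selection theorem is required. *)

Set Implicit Arguments.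
Unset Strict Implicit.
Unset Printing Implicit Defensive.

Import Order.TTheory GRing.Theory Num.Theory.
Import numFieldNormedType.Exports.

Local Open Scope classical_set_scope.
Local Open Scope ring_scope.

(** * Inner regularity *)

Section inner_regularity.
Context (R : realType) (d : measure_display) (Z : measurableType d).
Variables (mu : {measure set Z -> \bar R}) (mu_fin : (mu setT < +oo)%E).

Lemma finite_measure_lt_pinfty (B : set Z) : measurable B -> (mu B < +oo)%E.
Proof.
by move=> mB; apply: le_lt_trans mu_fin; apply: le_measure; rewrite ?inE.
Qed.

Lemma nonincreasing_measure_le (F : (set Z)^nat) (e : R) :
  (forall n, measurable (F n)) -> nonincreasing_seq F ->
  \bigcap_n F n = set0 -> 0 < e -> exists n, (mu (F n) <= e%:E)%E.
Proof.
move=> mF niF F0 e0.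
have := nonincreasing_cvg_mu (finite_measure_lt_pinfty (mF 0)) mF
  (bigcapT_measurable mF) niF.
rewrite F0 measure0 => /(_ _ (@nbhs_open_ereal_lt R 0 (fun=> e) e0))[n _ nP].
by exists n; exact: ltW (nP n (leqnn n)).
Qed.

Lemma measure_bigcup_le (F : (set Z)^nat) (e : R) :
  (forall n, measurable (F n)) -> 0 <= e ->
  (forall n, (mu (F n) <= (e / (2 ^ n.+1)%:R)%:E)%E) ->
  (mu (\bigcup_n F n) <= e%:E)%E.
Proof.
move=> mF e0 Fe.
apply: (@le_trans _ _ (\sum_(n <oo) mu (F n))%E).
  by apply: measure_sigma_subadditive => //; exact: bigcupT_measurable.
apply: le_trans (epsilon_trick0 predT e0).
by apply: lee_nneseries => // n _ _; exact: measure_ge0.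
Qed.

Variables (E : topologicalType) (h : Z -> E).

(* [Z] carries the sigma-algebra and [E] the topology: a standard Borel space is
   only isomorphic to a Polish space, through the second component of [h]. *)
Definition inner_regular (B : set Z) := forall e : R, 0 < e ->
  exists K : set E, [/\ closed K, measurable (h @^-1` K), h @^-1` K `<=` B &
    (mu (B `\` h @^-1` K) <= e%:E)%E].

Lemma inner_regular_closed (K : set E) :
  closed K -> measurable (h @^-1` K) -> inner_regular (h @^-1` K).
Proof.
by move=> cK mK e e0; exists K; split=> //; rewrite setDv measure0 lee_fin ltW.
Qed.

(** Approximate [F n] within [e / 2 ^ n.+1] and intersect the closed sets: what is lost lies in the
    union of the separate losses. *)
Lemma inner_regular_bigcap (F : (set Z)^nat) :
  (forall n, measurable (F n)) -> (forall n, inner_regular (F n)) ->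
  inner_regular (\bigcap_n F n).
Proof.
move=> mF rF e e0.
have e2 n : 0 < e / (2 ^ n.+1)%:R by rewrite divr_gt0// ltr0n expn_gt0.
have /all_sig[K KP] n := cid (rF n _ (e2 n)).
have mK : measurable (h @^-1` (\bigcap_n K n)).
  by rewrite preimage_bigcap; apply: bigcapT_measurable => n; have [] := KP n.
have mFK n : measurable (F n `\` h @^-1` K n).
  by have [_ ? _ _] := KP n; exact: measurableD.
exists (\bigcap_n K n); split => //.
- by apply: closed_bigI => n _; have [] := KP n.
- by move=> z Kz n _; have [_ _ + _] := KP n; apply; exact: Kz.
apply: (@le_trans _ _ (mu (\bigcup_n (F n `\` h @^-1` K n)))).
  apply: le_measure; rewrite ?inE.
  - by apply: measurableD => //; exact: bigcapT_measurable.
  - exact: bigcupT_measurable.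
  - move=> z [Fz /existsNP[n /not_implyP[_ nK]]]; exists n => //.
    by split => //; exact: Fz.
by apply: measure_bigcup_le => // [|n]; [exact: ltW|have [] := KP n].
Qed.

(** A countable union of closed sets need not be closed, so it is cut to a finite union [U N]: half
    of [e] pays for the approximations, half for the cut. *)
Lemma inner_regular_bigcup (F : (set Z)^nat) :
  (forall n, measurable (F n)) -> (forall n, inner_regular (F n)) ->
  inner_regular (\bigcup_n F n).
Proof.
move=> mF rF e e0; have e20 : 0 < e / 2 by rewrite divr_gt0.
have e2 n : 0 < e / 2 / (2 ^ n.+1)%:R by rewrite divr_gt0// ltr0n expn_gt0.
have /all_sig[K KP] n := cid (rF n _ (e2 n)).
have mK n : measurable (h @^-1` K n) by have [] := KP n.
have mFK n : measurable (F n `\` h @^-1` K n) by exact: measurableD.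
pose U n := \big[setU/set0]_(i < n) K i.
have hU n : h @^-1` U n = \bigcup_(i < n) (h @^-1` K i).
  by rewrite /U -bigcup_mkord preimage_bigcup.
have mU n : measurable (h @^-1` U n).
  by rewrite hU; exact: bigcup_measurable.
pose KK := \bigcup_n (h @^-1` K n).
have mKK : measurable KK by exact: bigcupT_measurable.
have [N muN] : exists n, (mu (KK `\` h @^-1` U n) <= (e / 2)%:E)%E.
  apply: nonincreasing_measure_le => //.
  - by move=> n; exact: measurableD.
  - move=> m n mn; apply/subsetPset; apply: setDS; rewrite !hU.
    by move=> z [i /= im Kz]; exists i => //=; exact: leq_trans mn.
  - rewrite -subset0 => z /= Kz; have [[n _ Knz] _] := Kz 0%N Logic.I.
    by have [_] := Kz n.+1 Logic.I; apply; rewrite hU; exists n => //=.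
exists (U N); split => //.
- by apply: closed_bigsetU => n _; have [] := KP n.
- by rewrite hU => z [n _ Kz]; exists n => //; have [_ _ + _] := KP n; exact.
have -> : e%:E = (e / 2)%:E + (e / 2)%:E :> \bar R by rewrite -EFinD -splitr.
apply: (@le_trans _ _ (mu ((\bigcup_n (F n `\` h @^-1` K n)) `|`
    (KK `\` h @^-1` U N)))).
  apply: le_measure; rewrite ?inE.
  - by apply: measurableD => //; exact: bigcupT_measurable.
  - by apply: measurableU; [exact: bigcupT_measurable|exact: measurableD].
  - move=> z [[n _ Fz] nU]; have [Kz|nKz] := pselect ((h @^-1` K n) z).
      by right; split => //; exists n.
    by left; exists n.
apply: (le_trans (measureU2 _ _ _)).
- exact: bigcupT_measurable.
- exact: measurableD.
apply: leeD => //; apply: measure_bigcup_le => // [|n]; first exact: ltW.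
by have [] := KP n.
Qed.

Definition regular (B : set Z) :=
  [/\ measurable B, inner_regular B & inner_regular (~` B)].

Lemma regular_sigma_algebra : sigma_algebra setT regular.
Proof.
have r0 : inner_regular set0.
  by rewrite -(preimage_set0 h); apply: inner_regular_closed;
    rewrite ?preimage_set0//; exact: closed0.
have rT : inner_regular setT.
  by rewrite -(preimage_setT h); apply: inner_regular_closed;
    rewrite ?preimage_setT//; exact: closedT.
split=> [|B [mB rB rCB]|F rF].
- by split=> //; rewrite setC0.
- by rewrite setTD; split=> //; [exact: measurableC|rewrite setCK].
- have mF n : measurable (F n) by have [] := rF n.
  split; first exact: bigcupT_measurable.
    by apply: inner_regular_bigcup => // n; have [] := rF n.
  rewrite setC_bigcup; apply: inner_regular_bigcap => n.
    exact: measurableC.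
  by have [] := rF n.
Qed.

End inner_regularity.

(** * Regularity of Borel sets in metric spaces *)

Section metric_regularity.
Context (R : realType) (N : pseudoMetricType R).

(** [F n] keeps the points at distance about [1 / n.+1] from the complement of [O]. Balls of a
    pseudometric type need not be open, hence the interiors. *)
Lemma open_bigcup_closed (O : set N) : open O ->
  exists F : (set N)^nat, (forall n, closed (F n)) /\ O = \bigcup_n F n.
Proof.
move=> oO.
exists (fun n => ~` \bigcup_(z in ~` O) (ball z n.+1%:R^-1)°); split=> [n|].
  by apply: open_closedC; apply: bigcup_open => z _; exact: open_interior.
apply/seteqP; split=> [x Ox|x [n _]].
  have /nbhs_ballP[r /= r0 rO] : nbhs x O by exact: open_nbhs_nbhs.
  have [k] := ltr_add_invr r0; rewrite add0r => kr.
  exists k => // -[z nOz /interior_subset xz]; apply/nOz/rO.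
  by apply: (le_ball (ltW kr)); exact: ball_sym.
apply: contra_notP => nOx; exists x => //.
apply: nbhs_singleton; apply: nbhs_interior; apply: nbhsx_ballx.
by rewrite invr_gt0 ltr0n.
Qed.

(** The sets with regular preimage form a sigma-algebra. It contains each open set, which is a
    countable union of closed sets and has a closed complement. *)
Lemma regular_preimage (d : measure_display) (Z : measurableType d)
  (mu : {measure set Z -> \bar R}) (E : topologicalType) (h : Z -> E)
  (g : E -> N) : (mu setT < +oo)%E -> continuous g ->
  (forall O, open O -> measurable ((g \o h) @^-1` O)) ->
  forall B, <<s open >> B -> regular mu h ((g \o h) @^-1` B).
Proof.
move=> mu_fin cg mgh B sB.
have [r0 rC rU] := regular_sigma_algebra mu_fin h.
apply: (sB (fun B => regular mu h ((g \o h) @^-1` B))).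
split=> [|O oO].
  split=> [|A rA|F rF].
  - by rewrite preimage_set0.
  - by rewrite setTD -preimage_setC -setTD; exact: rC.
  - by rewrite preimage_bigcup; exact: rU.
have mclosed C : closed C -> measurable ((g \o h) @^-1` C).
  move=> cC; rewrite -[C]setCK -preimage_setC; apply: measurableC.
  exact: (mgh _ (closed_openC cC)).
have closedP C : closed C -> inner_regular mu h ((g \o h) @^-1` C).
  move=> cC; rewrite comp_preimage; apply: inner_regular_closed.
    by apply: preimage_closed => // x _; exact: cg.
  exact: mclosed.
have [F [cF OF]] := open_bigcup_closed oO.
split; first exact: mgh.
  rewrite OF preimage_bigcup; apply: inner_regular_bigcup => // n.
    exact: mclosed.
  exact: closedP.
by rewrite preimage_setC; apply: closedP; exact: open_closedC.
Qed.

End metric_regularity.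

(** The product sigma-algebra is generated by preimages under the two coordinates, so each factor is
    treated alone, through a continuous projection of [R * M]. *)
Lemma measurable_prod_regular (R : realType) (d : measure_display)
  (A : measurableType d) (M : metricType R) (f : A -> M)
  (mu : {measure set (R * A) -> \bar R}) (B : set (R * A)) :
  (mu setT < +oo)%E ->
  (forall Y : set A, measurable Y -> exists2 C, <<s open >> C & Y = f @^-1` C) ->
  (forall O, open O -> measurable (f @^-1` O)) ->
  measurable B -> regular mu (fun wa => (wa.1, f wa.2)) B.
Proof.
move=> mu_fin fS fO; pose h wa : R * M := (wa.1, f wa.2); move: B.
suff : measurable `<=` regular mu h by [].
apply: smallest_sub; first exact: regular_sigma_algebra.
move=> B [[C mC <-]|[Y mY <-]]; rewrite setTI.
- have sC : <<s @open R >> C.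
    have : (@measurable _ R) C by [].
    rewrite [measurable]RGenOInfty.measurableE.
    apply: smallest_sub; first exact: smallest_sigma_algebra.
    by move=> _ [x ->]; apply: sub_sigma_algebra; exact: interval_open.
  apply: (@regular_preimage _ R _ _ mu _ h fst _ _ _ _ sC) => //.
    by move=> x; exact: cvg_fst.
  move=> O oO; rewrite -[X in measurable X]setTI.
  by apply: measurable_fst => //; exact: open_measurable.
- have [C sC ->] := fS _ mY.
  apply: (@regular_preimage _ M _ _ mu _ h snd _ _ _ _ sC) => //.
    by move=> x; exact: cvg_snd.
  move=> O oO; rewrite -[X in measurable X]setTI.
  exact: (@measurable_snd _ _ R A measurableT _ (fO _ oO)).
Qed.

(** * Tightness and compact selections *)

(** [q n] is the point of [D] with code [n]; codes not taken get [x0]. *)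
Lemma dense_seq (R : realType) (M : metricType R) (x0 : M) :
  (exists2 D : set M, countable D & dense D) ->
  exists q : nat -> M, forall (e : R) x, 0 < e -> exists i, ball (q i) e x.
Proof.
move=> [D /countable_injP[g ginj] dD].
exists (fun n => xget x0 [set x | D x /\ g x = n]) => e x e0.
have [y [/interior_subset xy Dy]] := dD _ (ex_intro _ x (open_nbhs_ball x (PosNum e0)).2)
  (open_nbhs_ball x (PosNum e0)).1.
exists (g y); case: xgetP => [z _ [Dz gzy]|/(_ y)[]//].
by rewrite (ginj _ _ _ _ gzy) ?inE//; exact: ball_sym.
Qed.

Section tightness.
Context (R : realType) (M : metricType R) (q : nat -> M).
Hypothesis M_complete : forall F : set_system M,
  ProperFilter F -> cauchy F -> exists l : M, F --> l.
Hypothesis q_dense : forall (e : R) x, 0 < e -> exists i, ball (q i) e x.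

(** For each [n], an ultrafilter on this set contains one of the finitely many balls of radius
    [1 / n.+1]. Hence it is Cauchy and converges, and the set is closed. *)
Lemma totally_bounded_compact (N : nat -> nat) : compact
  (\bigcap_n \big[setU/set0]_(i < N n) closed_ball (q i) n.+1%:R^-1).
Proof.
set C := \bigcap_n _.
have cC : closed C.
  by apply: closed_bigI => n _; apply: closed_bigsetU => i _; exact: closed_ball_closed.
rewrite compact_ultra => F UF FC.
have [l Fl] : exists l : M, F --> l.
  apply: M_complete; apply: cauchy_exP => e e0.
  have [n] := @ltr_add_invr _ 0 (e / 2) (divr_gt0 e0 (ltr0Sn _ 1)).
  rewrite add0r => ne.
  have : F (\big[setU/set0]_(i < N n) closed_ball (q i) n.+1%:R^-1).
    by apply: filterS FC => x; exact.
  elim: (N n) => [|m IH]; first by rewrite big_ord0 => /filter_ex[].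
  rewrite big_ord_recr /= => Fm.
  have [FU|FU] := in_ultra_setVsetC (\big[setU/set0]_(i < m)
    closed_ball (q i) n.+1%:R^-1) UF; first exact: IH.
  exists (q m); apply: filterS (filterI Fm FU) => x [[//|qx] _].
  by apply: subset_closure_half => //; exact: le_closed_ball (ltW ne) _ qx.
exists l; split=> //; apply: cC => B /Fl FB.
have FCB : F (C `&` B) by apply: filterI.
exact: filter_ex FCB.
Qed.

(** Ulam's tightness theorem: at scale [1 / n.+1] finitely many closed balls carry all but
    [e / 2 ^ n.+1] of the mass, and their intersection over [n] is compact. *)
Lemma tight_measure (d : measure_display) (Z : measurableType d)
  (mu : {measure set Z -> \bar R}) (f : Z -> M) (e : R) :
  (mu setT < +oo)%E -> (forall O, open O -> measurable (f @^-1` O)) -> 0 < e ->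
  exists C : set M, [/\ compact C, closed C & (mu (f @^-1` (~` C)) <= e%:E)%E].
Proof.
move=> mu_fin fO e0.
pose U n m := \big[setU/set0]_(i < m) closed_ball (q i) n.+1%:R^-1.
have cU n m : closed (U n m).
  by apply: closed_bigsetU => i _; exact: closed_ball_closed.
have mU n m : measurable (f @^-1` (~` U n m)) by exact: fO (closed_openC _).
have e2 n : 0 < e / (2 ^ n.+1)%:R by rewrite divr_gt0// ltr0n expn_gt0.
have Ne n : exists m, (mu (f @^-1` (~` U n m)) <= (e / (2 ^ n.+1)%:R)%:E)%E.
  apply: (@nonincreasing_measure_le _ _ _ mu mu_fin
    (fun m => f @^-1` (~` U n m))) => //.
  - apply/nonincreasing_seqP => m; apply/subsetPset => z; apply: contra_not.
    by rewrite /U big_ord_recr /=; left.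
  - rewrite -subset0 => z Uz.
    have n0 : 0 < n.+1%:R^-1 :> R by rewrite invr_gt0 ltr0n.
    have [i qi] := q_dense (f z) n0.
    by have := Uz i.+1 Logic.I; apply; rewrite /U big_ord_recr /=; right;
      exact: subset_closed_ball.
have /all_sig[N NP] n := cid (Ne n).
exists (\bigcap_n U n (N n)); split.
- exact: totally_bounded_compact.
- exact: closed_bigI.
rewrite setC_bigcap preimage_bigcup; apply: measure_bigcup_le => //.
exact: ltW.
Qed.

End tightness.

(** The tube lemma: if the section over [w] misses [C], each point of [C] has a product
    neighbourhood off [K], and by compactness one neighbourhood of [w] serves all of them. *)
Lemma closed_fst_compact (W M : topologicalType) (K : set (W * M)) (C : set M) :
  closed K -> compact C -> closed [set w | exists2 m, C m & K (w, m)].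
Proof.
move=> cK /compact_near_coveringP cC.
rewrite -[X in closed X]setCK; apply: open_closedC; rewrite openE => w nw.
have : \forall w' \near w, C `<=` (fun m => ~ K (w', m)).
  apply: (cC W (nbhs w) (fun w' m => ~ K (w', m))) => m Cm.
  have : nbhs (w, m) (~` K).
    apply: open_nbhs_nbhs; split; first exact: closed_openC.
    by move=> Kwm; apply: nw; exists m.
  case=> -[P Q] /= [Pw Qm] PQ; exists (Q, P) => //= -[m' w'] /= [Qm' Pw'].
  exact: (PQ (w', m')).
by apply: filterS => w' Cw' [m /Cw'].
Qed.

Lemma pair_continuous (W M : topologicalType) (w : W) :
  continuous (pair w : M -> W * M).
Proof. by move=> m; apply: cvg_pair => /=; [exact: cvg_cst|exact: cvg_id]. Qed.

(** * Borel selectors of closed sets with compact sections *)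

Section selection.
Context (R : realType) (M : metricType R) (q : nat -> M).
Hypothesis q_dense : forall (e : R) x, 0 < e -> exists i, ball (q i) e x.
Variables (K : set (R * M)) (C : set M).
Hypotheses (K_closed : closed K) (C_compact : compact C) (C_closed : closed C).

(* Codes grow at the head: the last digit of [s] is the first one chosen. The
   radii shrink with the length of [s], so a branch determines a point. *)
Fixpoint cell (s : seq nat) : set M :=
  if s is i :: s' then cell s' `&` closed_ball (q i) (size s').+1%:R^-1
  else C.

Let shadow (s : seq nat) := [set w | exists2 m, cell s m & K (w, m)].

(* [w] is in [least_cell s] if [s] is the code obtained for [w] by always
   choosing the least digit that keeps the section of [K] over [w] in reach. *)
Fixpoint least_cell (s : seq nat) : set R :=
  if s is i :: s' then
    (least_cell s' `&` shadow s) `\` \bigcup_(j < i) shadow (j :: s')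
  else shadow [::].

Lemma cell_closed s : closed (cell s).
Proof.
by elim: s => [//|i s IH]; apply: closedI => //; exact: closed_ball_closed.
Qed.

(** Compactness enters here: the projection of a Borel set may fail to be Borel, but a closed set
    projects along a compact cell onto a closed set. *)
Lemma shadow_closed s : closed (shadow s).
Proof.
apply: closed_fst_compact => //.
apply: (subclosed_compact (@cell_closed s) C_compact).
by elim: s => [//|i s IH] m [/IH].
Qed.

Lemma least_cell_measurable s : measurable (least_cell s).
Proof.
elim: s => [|i s IH].
  by apply: closed_measurable; exact: shadow_closed.
apply: measurableD.
  by apply: measurableI => //; apply: closed_measurable; exact: shadow_closed.
apply: bigcup_measurable => j _.
by apply: closed_measurable; exact: shadow_closed.
Qed.

Lemma least_cell_shadow s : least_cell s `<=` shadow s.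
Proof. by case: s => [//|i s] w [[]]. Qed.

(** By density, a point of the section in the current cell lies in some ball of the next radius, so
    a least admissible digit exists. *)
Lemma least_cell_ex w n : shadow [::] w ->
  exists2 s, size s = n & least_cell s w.
Proof.
move=> w0; elim: n => [|n [s sn sw]]; first by exists [::].
have [m sm Kwm] := least_cell_shadow sw.
have n0 : 0 < (size s).+1%:R^-1 :> R by rewrite invr_gt0 ltr0n.
have ex : exists i, `[< shadow (i :: s) w >].
  have [i qi] := q_dense m n0.
  by exists i; apply/asboolP; exists m => //; split=> //; exact: subset_closed_ball.
case: (ex_minnP ex) => i /asboolP iw imin; exists (i :: s); first by rewrite /= sn.
split=> // -[j /= ji /asboolP /imin]; by rewrite leqNgt ji.
Qed.

Lemma least_cell_uniq w s s' : size s = size s' ->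
  least_cell s w -> least_cell s' w -> s = s'.
Proof.
elim: s s' => [|i s IH] [|j s']//= [ss'] [[sw iw] iNw] [[s'w jw] jNw].
have {}IH := IH _ ss' sw s'w; subst s'; congr cons.
case: (ltngtP i j) => // ij.
- by case: jNw; exists i.
- by case: iNw; exists j.
Qed.

(** As codes grow at the head, [drop] returns to an earlier stage of the choice. *)
Lemma least_cell_drop w s k : least_cell s w -> least_cell (drop k s) w.
Proof. by elim: s k => [|i s IH] [|k]//= [[/IH]]. Qed.

Lemma cell_drop s k : cell s `<=` cell (drop k s).
Proof. by elim: s k => [|i s IH] [|k]//= m [/IH]. Qed.

(** Take a point of the section in the chosen cell of each length. A cluster point works, because
    each chosen cell is closed and contains all later points. *)
Lemma least_cell_bigcap w : shadow [::] w ->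
  exists m, K (w, m) /\ forall s, least_cell s w -> cell s m.
Proof.
move=> w0.
have /all_sig2[c cn cw] n := cid2 (least_cell_ex n w0).
have /all_sig2[m mc Kwm] n := cid2 (least_cell_shadow (cw n)).
have mC : (m @ \oo) C.
  by exists 0%N => // n _; have := cell_drop (size (c n)) (mc n); rewrite drop_size.
have [p [Cp mp]] := C_compact _ mC.
have pP F : closed F -> (m @ \oo) F -> F p.
  by move=> cF mF; apply: cF => B Bp; exact: mp.
exists p; split.
  apply: (pP [set m | K (w, m)]); last first.
    by exists 0%N => // n _; exact: Kwm.
  apply: (@preimage_closed _ _ (pair w) K _ K_closed) => x _.
  exact: pair_continuous.
move=> s sw; apply: pP; first exact: cell_closed.
exists (size s) => // n /= sn.
(* By uniqueness [s] is an earlier stage of the code [c n], so [m n] lies in its cell. *)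
have -> : s = drop (n - size s) (c n).
  by apply: (@least_cell_uniq w) => //; [rewrite size_drop cn subKn|exact: least_cell_drop].
exact: cell_drop.
Qed.

(** Over the projection, the selector lands in an open [O] exactly when some chosen cell is
    contained in [O], and there are countably many codes. *)
Lemma compact_selection : exists sel : R -> M,
  (forall w m, C m -> K (w, m) -> K (w, sel w)) /\
  (forall O, open O ->
    measurable ([set w | exists2 m, C m & K (w, m)] `&` sel @^-1` O)).
Proof.
have /all_sig[sel selP] w : {m | shadow [::] w ->
    K (w, m) /\ forall s, least_cell s w -> cell s m}.
  have [/least_cell_bigcap/cid[m mP]|nw] := pselect (shadow [::] w).
    by exists m.
  by exists (q 0%N) => /nw.
exists sel; split=> [w m Cm Kwm|O oO].
  by have [] := selP w (ex_intro2 _ _ m Cm Kwm).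
rewrite (_ : _ `&` _ = \bigcup_(s in [set s | cell s `<=` O]) least_cell s).
  rewrite bigcup_mkcond; apply: countable_bigcupT_measurable => // s.
  by case: ifPn => // _; exact: least_cell_measurable.
apply/seteqP; split=> [w [w0 Ow]|w [s /= sO sw]]; last first.
  have w0 : shadow [::] w.
    by have := least_cell_drop (size s) sw; rewrite drop_size.
  by split=> //; apply: sO; have [_] := selP _ w0; exact.
have /nbhs_ballP[r /= r0 rO] : nbhs (sel w) O by exact: open_nbhs_nbhs.
(* A last radius below [r / 4] puts the cell, selected point included, within [r / 2] of [q i],
   hence within [r] of the selected point. *)
have r20 : 0 < r / 2 by rewrite divr_gt0.
have [n] := @ltr_add_invr _ 0 (r / 2 / 2) (divr_gt0 r20 (ltr0Sn _ 1)).
rewrite add0r => nr.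
have [[|i s]//= [sn] sw] := least_cell_ex n.+1 w0.
exists (i :: s) => //= y [_ iy]; apply: rO.
have [_ /(_ (i :: s) sw)[_ iw]] := selP _ w0.
have sub : closed_ball (q i) (size s).+1%:R^-1 `<=` ball (q i) (r / 2).
  apply: subset_trans (subset_closure_half r20); apply: le_closed_ball.
  by rewrite sn ltW.
by rewrite [r]splitr; apply: ball_triangle (sub _ iy); apply/ball_sym/sub.
Qed.

End selection.

(** * Selections on standard Borel spaces *)

Section standard_borel_selection.
Context (R : realType) (d : measure_display) (A : measurableType d).

(** Half of [e] pays for a closed [K] that fills [B] from inside, half for a compact [C] of actions.
    [D] is the projection of the part of [K] over [C]; off [D] the selector is [point]. *)
Lemma measurable_selection (mu : {measure set (R * A) -> \bar R})
  (B : set (R * A)) (e : R) : standard_borel R A ->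
  (mu setT < +oo)%E -> measurable B -> 0 < e ->
  exists (D : set R) (s : R -> A), [/\ measurable D, measurable_fun setT s,
    forall w, D w -> B (w, s w) & (mu (B `\` fst @^-1` D) <= e%:E)%E].
Proof.
move=> [M [f [[M_complete M_sep] [g fK gK] fB]]] mu_fin mB e0.
have e20 : 0 < e / 2 by rewrite divr_gt0.
have [q q_dense] := dense_seq (f point) M_sep.
have fO O : open O -> measurable (f @^-1` O).
  by move=> oO; apply/fB; exact: sub_sigma_algebra.
have fimgK (Y : set A) : f @^-1` (g @^-1` Y) = Y.
  by apply/seteqP; split=> a /=; rewrite fK.
have fS (Y : set A) : measurable Y -> exists2 C, <<s open >> C & Y = f @^-1` C.
  by move=> mY; exists (g @^-1` Y) => //; apply/fB; rewrite fimgK.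
have [_ /(_ _ e20)[K [cK mK KB muK]] _] := measurable_prod_regular mu_fin fS fO mB.
set h := (fun wa : R * A => (wa.1, f wa.2)) in mK KB muK.
have fsO O : open O -> measurable ((f \o snd) @^-1` O : set (R * A)).
  move=> oO; rewrite -[X in measurable X]setTI.
  exact: (@measurable_snd _ _ R A measurableT _ (fO _ oO)).
have [C [C_compact C_closed muC]] :=
  tight_measure M_complete q_dense mu_fin fsO e20.
have [sel [selK sel_meas]] := compact_selection q_dense cK C_compact C_closed.
set D := [set w | exists2 m, C m & K (w, m)] in sel_meas.
have mD : measurable D.
  by apply: closed_measurable; exact: closed_fst_compact.
(* The sets [C'] with this property form a sigma-algebra, with complements taken inside [D]; this
   passes from open to Borel sets. *)
have mDsel C' : <<s open >> C' -> measurable (D `&` sel @^-1` C').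
  move=> sC'; apply: (sC' (fun B => measurable (D `&` sel @^-1` B))).
  split=> [|O oO]; last exact: sel_meas.
  split=> [|Y mY|F mF].
  - by rewrite preimage_set0 setI0.
  - rewrite (_ : D `&` _ = D `\` (D `&` sel @^-1` Y)); first exact: measurableD.
    by rewrite setDIr setDv set0U setTD -preimage_setC setDE.
  - rewrite preimage_bigcup setI_bigcupr; exact: bigcupT_measurable.
exists D, ((g \o sel) \_ D); split => //.
- apply: (iffLR (measurable_restrictT (g \o sel) mD)) => _ Y mY.
  have [C' sC' ->] := fS _ mY.
  have -> : (g \o sel) @^-1` (f @^-1` C') = sel @^-1` C'.
    by apply/seteqP; split=> w /=; rewrite gK.
  exact: (mDsel C' sC').
- move=> w Dw; have [m Cm Kwm] := Dw.
  rewrite patchE mem_set//=; apply: KB; rewrite /h /= gK.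
  exact: (selK w m).
- have mfC : measurable ((f \o snd) @^-1` (~` C) : set (R * A)).
    by apply: fsO; exact: closed_openC.
  have mBK : measurable (B `\` h @^-1` K) by exact: measurableD.
  have mfD : measurable (fst @^-1` D : set (R * A)).
    by rewrite -[X in measurable X]setTI; exact: measurable_fst.
  apply: (@le_trans _ _ (mu ((B `\` h @^-1` K) `|` (f \o snd) @^-1` (~` C)))).
    apply: le_measure; rewrite ?inE.
    + exact: measurableD.
    + exact: measurableU.
    + move=> [w a] /= [Bwa nDw]; have [Ca|nCa] := pselect (C (f a)).
        by left; split => // Kwa; apply: nDw; exists (f a).
      by right.
  have -> : e%:E = ((e / 2)%:E + (e / 2)%:E)%E by rewrite -EFinD -splitr.
  exact: le_trans (measureU2 _ mBK mfC) (leeD muK muC).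
Qed.

(* [N] is a set of state-action pairs, not of states: the selector beats
   every pair outside [N], and [mu] need not charge the graph of [s]. It combines
   the selectors of the superlevel sets of [Q] at the multiples of [e]. *)
Lemma near_optimal_selection (mu : {measure set (R * A) -> \bar R})
  (Q : R * A -> R) (b e : R) : standard_borel R A ->
  (mu setT < +oo)%E -> measurable_fun setT Q -> (forall wa, 0 <= Q wa <= b) ->
  0 < e ->
  exists (s : R -> A) (N : set (R * A)), [/\ measurable_fun setT s,
    measurable N, (mu N <= e%:E)%E &
    forall w a, ~ N (w, a) -> Q (w, a) <= Q (w, s w) + e].
Proof.
move=> hA mu_fin mQ Qb e0.
(* As [Q <= b], only levels [k * e] with [k <= n] are reached; level [0] is free and each of the
   other [n] costs [dl], which adds up to [e]. *)
pose n := (Num.truncn (b / e)).+1; pose dl := e / n%:R.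
have n0 : 0 < n%:R :> R by rewrite ltr0n.
have dl0 : 0 < dl by rewrite divr_gt0.
suff /(_ n)[s [N [ms mN muN NQ]]] : forall m, exists (s : R -> A) (N : set (R * A)),
    [/\ measurable_fun setT s, measurable N, (mu N <= (m%:R * dl)%:E)%E &
    forall w a k, ~ N (w, a) -> (k <= m)%N ->
      k%:R * e <= Q (w, a) -> k%:R * e <= Q (w, s w)].
  exists s, N; split=> // [|w a Nwa].
    by rewrite (le_trans muN)// lee_fin /dl mulrC divfK// gt_eqF.
  have /andP[Q0 Qb'] := Qb (w, a).
  have /truncn_itv/andP[kQ Qk] : 0 <= Q (w, a) / e by rewrite divr_ge0// ltW.
  have kn : (Num.truncn (Q (w, a) / e) <= n)%N.
    by apply: leqW; apply: le_truncn; rewrite ler_pM2r// invr_gt0.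
  have := NQ w a _ Nwa kn; rewrite ler_pdivlMr// in kQ => /(_ kQ) kQs.
  move: Qk; rewrite ltr_pdivrMr// -natr1 mulrDl mul1r => /ltW/le_trans; apply.
  by rewrite lerD2r.
elim=> [|m [s [N [ms mN muN NQ]]]].
  exists (cst point), set0; split => //; first by rewrite measure0 mul0r.
  by move=> w a k _; rewrite leqn0 => /eqP -> _; rewrite mul0r; case/andP: (Qb (w, point)).
have mB : measurable [set wa | m.+1%:R * e <= Q wa].
  rewrite -[X in measurable X]setTI.
  have := mQ measurableT _ (measurable_itv `[m.+1%:R * e, +oo[).
  by congr (measurable (_ `&` _)); apply/seteqP; split=> wa /=; rewrite in_itv/= andbT.
have [D [t [mD mt DB muB]]] := measurable_selection hA mu_fin mB dl0.
have mfD : measurable (fst @^-1` D : set (R * A)).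
  by rewrite -[X in measurable X]setTI; exact: measurable_fst.
have mBD := measurableD mB mfD.
(* The selector [t] of the new level takes priority on its domain [D]; the pairs of that level not
   over [D] join the exceptional set. *)
exists (fun w => if w \in D then t w else s w),
  (N `|` ([set wa | m.+1%:R * e <= Q wa] `\` fst @^-1` D)); split.
- apply: measurable_fun_ifT => //; apply: (measurable_fun_bool true).
  rewrite setTI (_ : _ @^-1` _ = D)//.
  by apply/seteqP; split=> w; [exact: set_mem|exact: mem_set].
- exact: measurableU.
- apply: (le_trans (measureU2 _ mN mBD)).
  have -> : m.+1%:R * dl = m%:R * dl + dl by rewrite -natr1 mulrDl mul1r.
  by rewrite EFinD leeD.
- move=> w a k /= /not_orP[Nwa BDwa] km kQ; case: ifPn => [|wD].
    rewrite inE => /DB /=; apply: le_trans.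
    by rewrite ler_wpM2r ?ler_nat// ltW.
  move: km; rewrite leq_eqVlt => /predU1P[km|km]; last exact: (NQ w a k).
  by case: BDwa; rewrite -km; split=> //=; rewrite notin_setE in wD.
Qed.
End standard_borel_selection.

(** * Independence of the next observation *)

Lemma pushforward_exists (R : realType) (d1 d2 : measure_display)
  (T : measurableType d1) (U : measurableType d2)
  (mu : {measure set T -> \bar R}) (f : T -> U) : measurable_fun setT f ->
  exists nu : {measure set U -> \bar R},
    (forall B, nu B = mu (f @^-1` B)) /\
    (forall g : U -> \bar R, measurable_fun setT g -> (forall y, 0 <= g y)%E ->
      (\int[nu]_y g y = \int[mu]_x g (f x))%E).
Proof.
move=> mf; unshelve eexists (pushforward mu f : {measure set U -> \bar R}).
  exact: mf.
by split=> // g mg g0; rewrite ge0_integral_pushforward.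
Qed.

(** Selection is applied to the joint law of [W] and [a] with tolerance [dl = e / (1 + b)]. The loss
    is at most [dl] off [N] and at most [b] on [N], whose mass is at most [dl]; in total
    [dl + b * dl = e]. *)
Lemma integral_near_optimal_selection (R : realType) (dA dT : measure_display)
  (A : measurableType dA) (T : measurableType dT) (P : probability T R)
  (S : set T) (W : T -> R) (a : T -> A) (Q : R * A -> R) (b e : R) :
  standard_borel R A -> measurable S -> measurable_fun setT W ->
  measurable_fun setT a -> measurable_fun setT Q ->
  (forall wa, 0 <= Q wa <= b) -> 0 < e ->
  exists s : R -> A, measurable_fun setT s /\
    (\int[P]_(x in S) (Q (W x, a x))%:E <=
     \int[P]_(x in S) (Q (W x, s (W x)))%:E + e%:E)%E.
Proof.
move=> hA mS mW ma mQ Qb e0.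
have b0 : 0 <= b by have /andP[] := Qb (0, point); exact: le_trans.
have b1 : 0 < 1 + b by rewrite ltr_pwDl.
have dl0 : 0 < e / (1 + b) by rewrite divr_gt0.
set dl := e / (1 + b) in dl0.
have mWa : measurable_fun setT (fun x => (W x, a x)) by exact: measurable_fun_pair.
have [mu [muE _]] := pushforward_exists P mWa.
have mu_fin : (mu setT < +oo)%E.
  rewrite muE; apply: (le_lt_trans (probability_le1 P measurableT)).
  exact: ltry.
have [s [N [ms mN muN sQ]]] := near_optimal_selection hA mu_fin mQ Qb dl0.
exists s; split => //.
pose N' := (fun x => (W x, a x)) @^-1` N.
have mN' : measurable N' by rewrite -[X in measurable X]setTI; exact: mWa.
have mQs : measurable_fun setT (fun x => Q (W x, s (W x))).
  apply: measurableT_comp => //; apply: measurable_fun_pair => //.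
  exact: measurableT_comp.
have Q0 wa : (0 <= (Q wa)%:E)%E by rewrite lee_fin; case/andP: (Qb wa).
have mg : measurable_fun setT (fun x => (dl%:E + b%:E * (\1_N' x)%:E)%E).
  apply: emeasurable_funD => //; apply: measurable_funeM.
  by apply/measurable_EFinP; exact: measurable_indic.
have g0 x : (0 <= dl%:E + b%:E * (\1_N' x)%:E)%E.
  by rewrite adde_ge0 ?mule_ge0// lee_fin// ltW.
apply: (@le_trans _ _ (\int[P]_(x in S) ((Q (W x, s (W x)))%:E +
    (dl%:E + b%:E * (\1_N' x)%:E)))%E).
  apply: ge0_le_integral => //.
  - by apply/measurable_EFinP; apply: measurable_funTS; exact: measurableT_comp.
  - apply: measurable_funTS; apply: emeasurable_funD => //.
    exact/measurable_EFinP.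
  - move=> x _; rewrite indicE.
    have [xN|] := boolP (x \in N').
      rewrite mule1 addeC -addeA -!EFinD lee_fin.
      have /andP[_ Qx] := Qb (W x, a x).
      have /andP[Qs _] := Qb (W x, s (W x)).
      by rewrite (le_trans Qx)// ler_wpDl ?lerDl// ltW.
    rewrite notin_setE => /sQ Qx.
    by rewrite mule0 adde0 -EFinD lee_fin.
rewrite ge0_integralD//; last 2 first.
- by apply/measurable_EFinP; exact: measurable_funTS.
- exact: measurable_funTS.
apply: leeD => //.
apply: (@le_trans _ _ (\int[P]_x (dl%:E + b%:E * (\1_N' x)%:E))%E).
  by apply: ge0_subset_integral.
rewrite ge0_integralD//; last 3 first.
- by move=> x _; rewrite lee_fin ltW.
- by move=> x _; rewrite mule_ge0// lee_fin.
- by apply: measurable_funeM; apply/measurable_EFinP; exact: measurable_indic.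
rewrite integral_cst// [X in (dl%:E * X)%E](_ : _ = 1%E); last first.
  exact: probability_setT.
rewrite mule1 ge0_integralZl//; last first.
  by apply/measurable_EFinP; exact: measurable_indic.
rewrite integral_indic// setIT.
apply: (@le_trans _ _ (dl%:E + b%:E * dl%:E)%E).
  by rewrite leeD2l// lee_wpmul2l ?lee_fin// -muE.
by rewrite -EFinM -EFinD lee_fin -{1}[dl]mul1r -mulrDl /dl mulrC divfK// gt_eqF.
Qed.

Section independence.
Context (R : realType) (d : measure_display) (X : measurableType d)
  (pi : probability X R) (P : probability (seq_space X) R).
Hypothesis hP : infinite_product pi P.

Lemma measurable_coord i : measurable_fun setT (fun x : seq_space X => x i).
Proof.
move=> _ Y mY; apply: sub_sigma_algebra; exists i => //; exact: (ex_intro2 _ _ Y).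
Qed.

Lemma measurable_prefix t :
  measurable_fun setT (fun x : seq_space X => Defs.prefix x t).
Proof.
apply/measurable_fun_tnthP => i.
have := measurable_coord i; congr measurable_fun.
by apply/funext => x /=; rewrite tnth_mktuple.
Qed.

(** The sides are indexed by [nat], the form in which [infinite_product] takes them. *)
Definition tuple_boxes t : set (set (t.-tuple X)) :=
  [set C | exists2 B : nat -> set X, forall i, measurable (B i) &
    C = [set h | forall i : 'I_t, B i (tnth h i)]].

Lemma measurable_tuple_boxes t :
  @measurable _ (t.-tuple X) = <<s @tuple_boxes t >>.
Proof.
apply/seteqP; split.
  apply: smallest_sub; first exact: smallest_sigma_algebra.
  move=> C; rewrite -bigcup_seq => -[i _ [Y mY <-]]; apply: sub_sigma_algebra.
  exists (fun j : nat => if j == i :> nat then Y else setT) => [j|]; first by case: ifP.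
  apply/seteqP; split=> h /=; last first.
    by move=> /(_ i); rewrite eqxx.
  by move=> [_ Yh] j; case: eqP => [/val_inj ->|].
apply: smallest_sub; first exact: sigma_algebra_measurable.
move=> _ [B mB ->].
rewrite (_ : [set _ | _] = \bigcap_(i in [set: 'I_t]) ((@tnth _ X ^~ i) @^-1` B i)).
  apply: fin_bigcap_measurable => // i _.
  by rewrite -[X in measurable X]setTI; exact: measurable_tnth.
by apply/seteqP; split=> h /= hB i; [move=> _|]; exact: hB.
Qed.

(** Both sides are finite measures in [C]. Boxes generate and are stable under intersection, and on
    a box the claim is the product formula with [B] as one more side. *)
Lemma prefix_coord_independent t (C : set (t.-tuple X)) (B : set X) :
  measurable C -> measurable B ->
  P [set x | C (Defs.prefix x t) /\ B (x t)] =
  (P [set x | C (Defs.prefix x t)] * pi B)%E.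
Proof.
move=> mC mB.
have mBt : measurable [set x : seq_space X | B (x t)].
  by rewrite -[X in measurable X]setTI; exact: measurable_coord.
have [m1 [m1E _]] := pushforward_exists (mrestr P mBt) (@measurable_prefix t).
have [m2 [m2E _]] := pushforward_exists P (@measurable_prefix t).
have piB : pi B = (fine (pi B))%:E by rewrite fineK// fin_num_measure.
pose m3 : {measure set (t.-tuple X) -> \bar R} :=
  mscale (NngNum (fine_ge0 (measure_ge0 pi B))) m2.
have m3E C' : m3 C' = (pi B * m2 C')%E by rewrite piB.
suff : m1 C = m3 C by rewrite m1E m3E m2E muleC.
apply: (measure_unique (@tuple_boxes t) (fun _ => setT)) => //.
- exact: measurable_tuple_boxes.
- move=> _ _ [B1 mB1 ->] [B2 mB2 ->].
  exists (fun i => B1 i `&` B2 i) => [i|]; first exact: measurableI.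
  apply/seteqP; split=> h /=; first by move=> [h1 h2] i; split.
  by move=> hB; split=> i; have [] := hB i.
- move=> _; exists (fun _ => setT) => //.
  by apply/seteqP; split.
- exact: bigcup_const.
- move=> _ [B' mB' ->].
  rewrite m1E m3E m2E /mrestr.
  have preE : (fun x : seq_space X => Defs.prefix x t) @^-1`
      [set h | forall i : 'I_t, B' i (tnth h i)] =
      [set x : seq_space X | forall i, (i < t)%N -> B' i (x i)].
    apply/seteqP; split=> x /= hB => [i it|i].
      by have := hB (Ordinal it); rewrite tnth_mktuple.
    by rewrite tnth_mktuple; exact: hB.
  pose B'' i := if (i < t)%N then B' i else B.
  have mB'' i : measurable (B'' i) by rewrite /B''; case: ifP.
  have intE : [set x : seq_space X | forall i, (i < t)%N -> B' i (x i)] `&`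
      [set x : seq_space X | B (x t)] =
      [set x : seq_space X | forall i, (i < t.+1)%N -> B'' i (x i)].
    apply/seteqP; split=> x /=.
      move=> [hB' hB] i; rewrite ltnS /B''; case: ltnP => [/hB'//|ti it].
      by have -> : i = t by apply: anti_leq; rewrite it ti.
    move=> hB; split=> [i it|].
      by have := hB i (ltnW it); rewrite /B'' it.
    by have := hB t (ltnSn t); rewrite /B'' ltnn.
  rewrite preE.
  transitivity (P [set x : seq_space X | forall i, (i < t.+1)%N -> B'' i (x i)]).
    by rewrite -intE.
  apply: (etrans (hP t.+1 mB'')).
  apply: etrans (esym (congr1 (fun z => (pi B * z)%E) (hP t mB'))).
  rewrite big_ord_recr [LHS]muleC /B'' /= ltnn; congr (_ * _)%E.
  by apply: eq_bigr => i _; rewrite ltn_ord.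
- move=> k; rewrite m1E; apply: (le_lt_trans (probability_le1 P _)).
    by apply: measurableI => //; rewrite preimage_setT.
  exact: ltry.
Qed.

(** By independence the prefix and the next observation have a product law, and Tonelli applies. *)
Lemma integral_prefix_coord t (G : t.-tuple X * X -> \bar R) :
  measurable_fun setT G -> (forall z, 0 <= G z)%E ->
  (\int[P]_x G (Defs.prefix x t, x t) =
   \int[P]_x \int[pi]_y G (Defs.prefix x t, y))%E.
Proof.
move=> mG G0.
have mpx : measurable_fun setT (fun x : seq_space X => (Defs.prefix x t, x t)).
  by apply: measurable_fun_pair; [exact: measurable_prefix|exact: measurable_coord].
have [nu [nuE nuI]] := pushforward_exists P mpx.
rewrite -(nuI _ mG G0).
pose pre : {mfun seq_space X >-> t.-tuple X} :=
  HB.pack (fun x : seq_space X => Defs.prefix x t)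
    (isMeasurableFun.Build _ _ _ _ _ (@measurable_prefix t)).
pose law := distribution P pre.
transitivity (\int[law \x pi]_z G z)%E.
  apply: eq_measure_integral => C mC _; apply/esym.
  apply: product_measure_unique => // C1 C2 mC1 mC2.
  by rewrite nuE -prefix_coord_independent.
rewrite fubini_tonelli1// ge0_integral_distribution//.
  exact: measurable_fun_fubini_tonelli_F.
by move=> h; exact: integral_ge0.
Qed.

End independence.

(** * Stopping and wealth processes *)

Section stopping.
Context (R : realType) (alpha : R) (rew : enat -> R).
Implicit Type W : nat -> R.

(** Time [0] is not tested, in accordance with [rejection_time]. *)
Fixpoint alive W t : bool :=
  if t is s.+1 then alive W s && (W s.+1 < alpha^-1) else true.

(** This is the reward truncated at horizon [t], in a recursive form from which a single round can
    be split off. *)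
Fixpoint banked W t : R :=
  if t is s.+1 then
    if alive W s && (alpha^-1 <= W s.+1) then rew (Some s.+1) else banked W s
  else 0.

Lemma aliveS W t : alive W t.+1 = alive W t && (W t.+1 < alpha^-1).
Proof. by []. Qed.

Lemma bankedS W t : banked W t.+1 =
  if alive W t && (alpha^-1 <= W t.+1) then rew (Some t.+1) else banked W t.
Proof. by []. Qed.

Lemma aliveP W t :
  reflect (forall s, (0 < s <= t)%N -> W s < alpha^-1) (alive W t).
Proof.
elim: t => [|t IH] /=; first by constructor => -[|s].
apply: (iffP andP) => [[/IH aW Wt] s /andP[s0]|aW].
  by rewrite leq_eqVlt => /predU1P[->//|st]; apply: aW; rewrite s0.
split; last by apply: aW; rewrite ltnS leqnn.
by apply/IH => s /andP[s0 st]; apply: aW; rewrite s0 ltnW.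
Qed.

Lemma alive_le W s t : (s <= t)%N -> alive W t -> alive W s.
Proof.
move=> st /aliveP aW; apply/aliveP => k /andP[k0 ks].
by apply: aW; rewrite k0 (leq_trans ks).
Qed.

Lemma alive_banked W t : alive W t -> banked W t = 0.
Proof.
elim: t => [//|t IH] /= /andP[aW Wt].
by rewrite aW /= leNgt Wt /= IH.
Qed.

Lemma rejection_time_None W :
  rejection_time alpha W = None -> forall t, alive W t.
Proof.
rewrite /rejection_time; case: pselect => // nex _ t.
apply/aliveP => s /andP[s0 _]; rewrite ltNge; apply/negP => Ws.
by apply: nex; exists s; rewrite s0.
Qed.

Lemma rejection_time_Some W t : rejection_time alpha W = Some t ->
  exists s, [/\ t = s.+1, alive W s & alpha^-1 <= W s.+1].
Proof.
rewrite /rejection_time; case: pselect => // ex [<-].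
case: ex_minnP => -[//|s] /= Ws smin; exists s; split=> //.
apply/aliveP => k /andP[k0 ks]; rewrite ltNge; apply/negP => Wk.
by have := smin k; rewrite k0 Wk => /(_ isT); rewrite leqNgt ltnS ks.
Qed.

Lemma eq_rejection_time W W' : alive W =1 alive W' ->
  rejection_time alpha W = rejection_time alpha W'.
Proof.
move=> WW'.
have key V V' s s' : alive V =1 alive V' -> alive V s ->
    alpha^-1 <= V' s'.+1 -> (s <= s')%N.
  move=> VV' Vs V's'; rewrite leqNgt; apply/negP => ss'.
  have := alive_le ss' Vs; rewrite VV' /= => /andP[_].
  by rewrite ltNge V's'.
case E : (rejection_time alpha W) => [t|]; case E' : (rejection_time alpha W') => [t'|//].
- have [s [-> Ws Ws1]] := rejection_time_Some E.
  have [s' [-> Ws' Ws1']] := rejection_time_Some E'.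
  congr (Some _.+1); apply: anti_leq.
  by rewrite (key _ _ _ _ WW' Ws Ws1') (key _ _ _ _ (fsym WW') Ws' Ws1).
- have [s [_ _ Ws1]] := rejection_time_Some E.
  have := rejection_time_None E' s.+1; rewrite -WW' /= ltNge Ws1.
  by rewrite andbF.
- have [s [_ _ Ws1]] := rejection_time_Some E'.
  have := rejection_time_None E s.+1; rewrite WW' /= ltNge Ws1.
  by rewrite andbF.
Qed.

Hypothesis hrew : reward_function rew.

Lemma banked_rejection_time W t : banked W t =
  if rejection_time alpha W is Some s then
    if (s <= t)%N then rew (Some s) else 0
  else 0.
Proof.
case E : (rejection_time alpha W) => [s|]; last first.
  by rewrite alive_banked//; exact: rejection_time_None.
have [k [-> Wk Wk1]] := rejection_time_Some E.
elim: t => [//|t IH].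
case: (ltngtP t k) => tk; last first.
- by rewrite tk /= Wk Wk1 ltnS leqnn.
- rewrite [banked _ _]/= IH tk ltnS (ltnW tk).
  case: ifPn => // /andP[/(alive_le tk)] /=.
  by rewrite ltNge Wk1 andbF.
- by rewrite ltnS leqNgt tk alive_banked//; exact: alive_le tk Wk.
Qed.

Lemma banked_bounds W t : 0 <= banked W t <= rew (Some 0%N).
Proof.
have [rew0 rewle _] := hrew.
by elim: t => [|t IH] /=; [rewrite lexx rew0|case: ifP => // _; rewrite rew0 rewle].
Qed.

Lemma banked_nondecreasing W : nondecreasing_seq (banked W).
Proof.
have [rew0 _ _] := hrew.
move=> s t st; rewrite !banked_rejection_time.
case: (rejection_time alpha W) => // k; case: ifP => ks; last by case: ifP.
by rewrite (leq_trans ks).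
Qed.

(** The sequence is constant from the rejection time on; without rejection it stays at [0], which is
    [rew None]. *)
Lemma banked_cvg W :
  (banked W t)%:E @[t --> \oo] --> (rew (rejection_time alpha W))%:E.
Proof.
have [_ _ rewN] := hrew.
pose T := if rejection_time alpha W is Some s then s else 0%N.
apply: cvg_near_cst; exists T => // t /= Tt.
rewrite banked_rejection_time; move: Tt; rewrite /T.
by case: (rejection_time alpha W) => [s ->|] //; rewrite rewN.
Qed.

End stopping.

(** * Measurability of wealth, and Markov policies as policies *)

Section wealth_processes.
Context (R : realType) (dX dA : measure_display)
  (X : measurableType dX) (A : measurableType dA)
  (phi : A * X -> R) (alpha : R).
Hypothesis hphim : measurable_fun setT phi.

(** The family [u] covers two cases at once: the sequences of [seq_space X] themselves and padded
    histories. *)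
Lemma measurable_prefix_of (dZ : measure_display) (Z : measurableType dZ)
  (u : Z -> nat -> X) t : (forall i, measurable_fun setT (fun z => u z i)) ->
  measurable_fun setT (fun z => Defs.prefix (u z) t).
Proof.
move=> mu; apply/measurable_fun_tnthP => i.
have := mu i; congr measurable_fun.
by apply/funext => x /=; rewrite tnth_mktuple.
Qed.

(** Padding makes the wealth a function of a finite history; after [t] rounds it does not see the
    added values. *)
Definition pad t (h : t.-tuple X) : nat -> X := fun i => nth point h i.

Lemma measurable_pad t i :
  measurable_fun setT (fun h : t.-tuple X => pad h i).
Proof.
have [it|ti] := ltnP i t.
  have := @measurable_tnth _ X t (Ordinal it); congr measurable_fun.
  by apply/funext => h; rewrite (tnth_nth point).
rewrite (_ : (fun _ => _) = cst point)//.
by apply/funext => h; rewrite /pad nth_default// size_tuple.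
Qed.

Lemma pad_prefix (x : nat -> X) t i : (i < t)%N -> pad (Defs.prefix x t) i = x i.
Proof. by move=> it; rewrite /pad (nth_mktuple _ _ (Ordinal it)). Qed.

Lemma eq_prefix (x y : nat -> X) t :
  (forall i, (i < t)%N -> x i = y i) -> Defs.prefix x t = Defs.prefix y t.
Proof. by move=> xy; apply: eq_from_tnth => i; rewrite !tnth_mktuple xy. Qed.

Section policy.
Variable pol : forall t : nat, t.-tuple X -> A.
Arguments pol : clear implicits.

Lemma eq_wealth (x y : nat -> X) t s : (s <= t)%N ->
  (forall i, (i < t)%N -> x i = y i) -> wealth phi pol x s = wealth phi pol y s.
Proof.
move=> + xy; elim: s => [//|s IH] st /=.
rewrite IH ?(ltnW st)// xy// (@eq_prefix x y)// => i si.
by apply: xy; exact: ltn_trans st.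
Qed.

Lemma eq_alive_wealth (x y : nat -> X) t :
  (forall i, (i < t)%N -> x i = y i) ->
  alive alpha (wealth phi pol x) t = alive alpha (wealth phi pol y) t.
Proof.
move=> xy; apply/aliveP/aliveP => aW s /andP[s0 st].
- by rewrite -(eq_wealth st xy); apply: aW; rewrite s0.
- by rewrite (eq_wealth st xy); apply: aW; rewrite s0.
Qed.

Hypothesis mpol : is_policy pol.
Context (dZ : measure_display) (Z : measurableType dZ) (u : Z -> nat -> X).
Hypothesis mu : forall i, measurable_fun setT (fun z => u z i).

Lemma measurable_wealth t :
  measurable_fun setT (fun z => wealth phi pol (u z) t).
Proof.
elim: t => [|t IH] /=; first exact: measurable_cst.
apply: measurable_funM => //; apply: measurableT_comp => //.
apply: measurable_fun_pair => //; apply: measurableT_comp; first exact: mpol.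
exact: measurable_prefix_of.
Qed.

Lemma measurable_alive t :
  measurable_fun setT (fun z => alive alpha (wealth phi pol (u z)) t).
Proof.
elim: t => [|t IH]; first exact: measurable_cst.
apply: measurable_and => //; apply: measurable_fun_ltr => //.
exact: (measurable_wealth t.+1).
Qed.

Lemma measurable_banked rew t :
  measurable_fun setT (fun z => banked alpha rew (wealth phi pol (u z)) t).
Proof.
elim: t => [|t IH]; first exact: measurable_cst.
apply: measurable_fun_ifT => //; apply: measurable_and.
  exact: measurable_alive.
by apply: measurable_fun_ler => //; exact: (measurable_wealth t.+1).
Qed.

End policy.

Section markov_policy.
Variable a : nat -> R -> A.
Hypothesis ma : forall t, measurable_fun setT (a t).

Lemma eq_markov_wealth (x y : nat -> X) t :
  (forall i, (i < t)%N -> x i = y i) ->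
  markov_wealth phi alpha a x t = markov_wealth phi alpha a y t.
Proof.
elim: t => [//|t IH] xy /=; rewrite IH ?xy// => i it.
by apply: xy; exact: ltnW.
Qed.

Lemma measurable_markov_wealth (dZ : measure_display) (Z : measurableType dZ)
  (u : Z -> nat -> X) t : (forall i, measurable_fun setT (fun z => u z i)) ->
  measurable_fun setT (fun z => markov_wealth phi alpha a (u z) t).
Proof.
move=> mu; elim: t => [|t IH] /=; first exact: measurable_cst.
apply: measurable_fun_ifT => //; first exact: measurable_fun_ltr.
apply: measurable_funM => //; apply: measurableT_comp => //.
by apply: measurable_fun_pair => //; exact: measurableT_comp.
Qed.

Definition markov_to_policy t (h : t.-tuple X) : A :=
  a t (markov_wealth phi alpha a (pad h) t).

Lemma markov_to_policy_is_policy : is_policy markov_to_policy.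
Proof.
move=> t; apply: measurableT_comp => //.
by apply: measurable_markov_wealth => i; exact: measurable_pad.
Qed.

Lemma markov_to_policy_prefix (x : nat -> X) t :
  markov_to_policy (Defs.prefix x t) = a t (markov_wealth phi alpha a x t).
Proof.
by rewrite /markov_to_policy; congr (a t _); apply: eq_markov_wealth => i; exact: pad_prefix.
Qed.

Hypothesis alpha1 : 0 < alpha < 1.

(** Freezing starts only after the first crossing, so the two wealths agree up to and including
    it. *)
Lemma alive_markov_to_policy (x : nat -> X) t :
  let W := wealth phi markov_to_policy x in
  let W' := markov_wealth phi alpha a x in
  alive alpha W t = alive alpha W' t /\ (alive alpha W t -> W t = W' t).
Proof.
move=> W W'; elim: t => [//|t [IHa IHW]].
have step : alive alpha W t -> W t.+1 = W' t.+1.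
  move=> aW; rewrite /W' /= -/W' /W /= -/W markov_to_policy_prefix IHW// -/W' ifT//.
  (* At time [0] survival says nothing about the wealth; [1 < alpha^-1] comes from [alpha < 1]. *)
  case: t aW IHa {IHW} => [|t]; last by move=> /[swap] -> /= /andP[].
  by move=> _ _; rewrite /= invf_gt1//; case/andP: alpha1.
split=> /=; last by move=> /andP[/step].
by rewrite -IHa; case aW : (alive alpha W t) => //=; rewrite step.
Qed.

Lemma rejection_time_markov_to_policy (x : nat -> X) :
  rejection_time alpha (wealth phi markov_to_policy x) =
  rejection_time alpha (markov_wealth phi alpha a x).
Proof.
by apply: eq_rejection_time => t; have [] := alive_markov_to_policy x t.
Qed.

End markov_policy.

(** The wealth is nonnegative and the action is consulted only below [alpha^-1], so the changed
    values are never read. *)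
Lemma markov_wealth_restrict (a : nat -> R -> A) (x : nat -> X) t :
  (forall ax, 0 <= phi ax) ->
  markov_wealth phi alpha (fun s => (a s) \_ `[0, alpha^-1[) x t =
  markov_wealth phi alpha a x t.
Proof.
move=> phi0; have W0 s : 0 <= markov_wealth phi alpha a x s.
  by elim: s => [|s IH] /=; [exact: ler01|case: ifP => // _; exact: mulr_ge0].
elim: t => [//|t IH] /=; rewrite IH; case: ifP => // Wa.
by rewrite patchE mem_set//= in_itv/= W0 Wa.
Qed.
End wealth_processes.

(** * Dynamic programming *)

Section dynamic_programming.
Context (R : realType) (dX dA : measure_display)
  (X : measurableType dX) (A : measurableType dA)
  (pi : probability X R) (P : probability (seq_space X) R).
Hypothesis hP : infinite_product pi P.
Variable alpha : R.
Hypothesis alpha1 : 0 < alpha < 1.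
Hypothesis hA : standard_borel R A.
Variable phi : A * X -> R.
Hypothesis hphim : measurable_fun setT phi.
Variable rew : enat -> R.
Hypothesis hrew : reward_function rew.

Let b := rew (Some 0%N).
Let coordm := @measurable_coord dX X.

Let alive_set (pol : forall t, t.-tuple X -> A) t : set (seq_space X) :=
  [set x | alive alpha (wealth phi pol x) t].

Lemma mem_alive_set pol t x :
  (x \in alive_set pol t) = alive alpha (wealth phi pol x) t.
Proof. by apply/idP/idP => [/set_mem|/mem_set]. Qed.

Lemma measurable_alive_set pol t : is_policy pol ->
  measurable (alive_set pol t).
Proof.
move=> mpol.
have := measurable_alive alpha hphim mpol coordm t measurableT (Y := [set true]) I.
by rewrite setTI.
Qed.

(* [bellman u (w, a)] is the expected value of [u] at the next wealth when [a]
   is played at wealth [w]. *)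
Definition bellman (u : R -> R) (wa : R * A) : R :=
  fine (\int[pi]_y (u (wa.1 * phi (wa.2, y)))%:E)%E.

Section bellman.
Variable u : R -> R.
Hypotheses (um : measurable_fun setT u) (ub : forall w, 0 <= u w <= b).

Let next (z : (R * A) * X) := (u (z.1.1 * phi (z.1.2, z.2)))%:E.

Let next_ge0 z : (0 <= next z)%E.
Proof. by rewrite lee_fin; case/andP: (ub (z.1.1 * phi (z.1.2, z.2))). Qed.

Let next_measurable : measurable_fun setT next.
Proof.
apply/measurable_EFinP; apply: measurableT_comp => //.
apply: measurable_funM.
  by apply: measurableT_comp => //; exact: measurable_fst.
apply: measurableT_comp => //; apply: measurable_fun_pair => //.
by apply: measurableT_comp => //; exact: measurable_snd.
Qed.

Let integral_le_b wa : (\int[pi]_y next (wa, y) <= b%:E)%E.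
Proof.
apply: (@le_trans _ _ (\int[pi]_y (cst b%:E) y)%E).
  apply: ge0_le_integral => //.
  - exact: measurableT_comp next_measurable (pair1_measurable wa).
  - by move=> y _; rewrite lee_fin; case/andP: (ub (wa.1 * phi (wa.2, y))).
rewrite integral_cst// [X in (_ * X)%E](_ : _ = 1%E) ?mule1//.
exact: probability_setT.
Qed.

Lemma bellmanE wa :
  (\int[pi]_y (u (wa.1 * phi (wa.2, y)))%:E)%E = (bellman u wa)%:E.
Proof.
rewrite /bellman fineK// ge0_fin_numE.
  exact: le_lt_trans (integral_le_b wa) (ltry _).
by apply: integral_ge0 => y _; exact: (next_ge0 (wa, y)).
Qed.

Lemma bellman_bounds wa : 0 <= bellman u wa <= b.
Proof.
rewrite -!lee_fin -bellmanE integral_le_b andbT.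
by apply: integral_ge0 => y _; exact: (next_ge0 (wa, y)).
Qed.

Lemma bellman_measurable : measurable_fun setT (bellman u).
Proof.
apply: (measurableT_comp (fine_measurable measurableT)).
exact: (measurable_fun_fubini_tonelli_F (m2 := pi) next next_measurable next_ge0).
Qed.

(** Survival, wealth and action depend on the first [t] observations only, and the next one is
    independent of them with law [pi]. *)
Lemma integral_next_wealth pol t : is_policy pol ->
  (\int[P]_(x in alive_set pol t) (u (wealth phi pol x t.+1))%:E =
   \int[P]_(x in alive_set pol t)
     (bellman u (wealth phi pol x t, pol t (Defs.prefix x t)))%:E)%E.
Proof.
move=> mpol.
pose w (h : t.-tuple X) := wealth phi pol (pad h) t.
pose G (z : t.-tuple X * X) : \bar R :=
  if alive alpha (wealth phi pol (pad z.1)) t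
  then (u (w z.1 * phi (pol t z.1, z.2)))%:E else 0%E.
have padm := @measurable_pad _ X t.
have mw : measurable_fun setT w := measurable_wealth hphim mpol padm t.
have mG : measurable_fun setT G.
  apply: measurable_fun_ifT => //.
    apply: (measurableT_comp (measurable_alive alpha hphim mpol padm t)).
    exact: measurable_fst.
  apply: (measurableT_comp (f := next)
    (g := fun z : t.-tuple X * X => ((w z.1, pol t z.1), z.2))) => //.
  apply: measurable_fun_pair => //; apply: measurable_fun_pair.
    by apply: measurableT_comp; [exact: mw|exact: measurable_fst].
  by apply: measurableT_comp; [exact: mpol|exact: measurable_fst].
have G0 z : (0 <= G z)%E.
  by rewrite /G; case: ifP => // _; rewrite lee_fin;
    case/andP: (ub (w z.1 * phi (pol t z.1, z.2))).
have wE x : wealth phi pol x t = w (Defs.prefix x t).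
  by apply: (eq_wealth phi pol (leqnn t)) => i it; rewrite pad_prefix.
have aE x : alive alpha (wealth phi pol x) t =
    alive alpha (wealth phi pol (pad (Defs.prefix x t))) t.
  by apply: eq_alive_wealth => i it; rewrite pad_prefix.
rewrite integral_mkcond [RHS]integral_mkcond.
transitivity (\int[P]_x G (Defs.prefix x t, x t))%E.
  by apply: eq_integral => x _; rewrite patchE /G /= mem_alive_set -aE wE.
rewrite (integral_prefix_coord hP)//; apply: eq_integral => x _.
rewrite patchE /G /= mem_alive_set -aE -wE.
case: (alive alpha (wealth phi pol x) t); first by rewrite -bellmanE.
by rewrite integral0.
Qed.

End bellman.

Implicit Type pol : forall t, t.-tuple X -> A.

Let gain pol t := (\int[P]_x (banked alpha rew (wealth phi pol x) t)%:E)%E.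

Let continuation (v : R -> R) pol t :=
  (\int[P]_(x in alive_set pol t) (v (wealth phi pol x t))%:E)%E.

Let next_value (v : R -> R) t w := if w < alpha^-1 then v w else rew (Some t).

(** The identity is pointwise: a path alive after [t] rounds has banked nothing, and then either
    crosses and is paid or survives with value [v]; other paths do not change. *)
Lemma gainS pol (v : R -> R) t : is_policy pol -> measurable_fun setT v ->
  (forall w, 0 <= v w <= b) ->
  (gain pol t.+1 + continuation v pol t.+1 = gain pol t +
   \int[P]_(x in alive_set pol t) (next_value v t.+1 (wealth phi pol x t.+1))%:E)%E.
Proof.
move=> mpol mv vb.
have [rew0 _ _] := hrew.
have v0 w : 0 <= v w by case/andP: (vb w).
have nv0 w : 0 <= next_value v t.+1 w by rewrite /next_value; case: ifP.
have bk0 x s : 0 <= banked alpha rew x s by case/andP: (banked_bounds alpha hrew x s).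
have mbk s : measurable_fun setT (fun x : seq_space X =>
    (banked alpha rew (wealth phi pol x) s)%:E).
  by apply/measurable_EFinP; exact: (measurable_banked alpha hphim mpol coordm rew s).
have mW s : measurable_fun setT (fun x : seq_space X => wealth phi pol x s).
  exact: (measurable_wealth hphim mpol coordm s).
have mnv : measurable_fun setT (next_value v t.+1).
  by apply: measurable_fun_ifT => //; exact: measurable_fun_ltr.
have mres (w : R -> R) s : measurable_fun setT w -> measurable_fun setT
    ((fun x : seq_space X => (w (wealth phi pol x t.+1))%:E) \_ (alive_set pol s)).
  move=> mw; apply: (iffLR (measurable_restrictT _ (measurable_alive_set s mpol))).
  by apply: measurable_funTS; apply/measurable_EFinP; exact: measurableT_comp.
have res0 (w : R -> R) s : (forall y, 0 <= w y) -> forall x,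
    (0 <= ((fun x : seq_space X => (w (wealth phi pol x t.+1))%:E) \_ (alive_set pol s)) x)%E.
  by move=> w0 x; rewrite patchE; case: ifP => // _; rewrite lee_fin.
rewrite /gain /continuation !(integral_mkcond (alive_set _ _)).
rewrite -ge0_integralD//; last 3 first.
- by move=> x _; rewrite lee_fin.
- by move=> x _; exact: res0.
- exact: mres.
rewrite -ge0_integralD//; last 3 first.
- by move=> x _; rewrite lee_fin.
- by move=> x _; exact: res0.
- exact: mres.
apply: eq_integral => x _; rewrite !patchE !mem_alive_set.
rewrite aliveS bankedS /next_value; move: (wealth phi pol x) => W.
have [aW|_] //= := boolP (alive alpha W t).
rewrite (alive_banked rew aW) leNgt add0e.
by case: (W t.+1 < alpha^-1); [exact: add0e|exact: adde0].
Qed.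

(** With [n] rounds left, [pol] exceeds the continuation value [v] by at most [e] per round, while a
    policy that plays [a] from [t] on attains it exactly, whatever its past. The actions depend on
    [pol], through the laws of wealth and action it induces. *)
Lemma backward_induction pol e n t : is_policy pol -> 0 < e ->
  exists (a : nat -> R -> A) (v : R -> R),
  [/\ forall s, measurable_fun setT (a s), measurable_fun setT v,
     forall w, 0 <= v w <= b,
     (gain pol (t + n) <= gain pol t + continuation v pol t + (n%:R * e)%:E)%E &
     forall pol', is_policy pol' ->
       (forall x s, (t <= s)%N -> alive alpha (wealth phi pol' x) s ->
          pol' s (Defs.prefix x s) = a s (wealth phi pol' x s)) ->
       gain pol' (t + n) = (gain pol' t + continuation v pol' t)%E].
Proof.
move=> mpol e0; have [rew0 rewle _] := hrew.
elim: n t => [|n IH] t.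
  exists (fun _ => cst point), (cst 0); split=> //.
  - by move=> w; rewrite lexx rew0.
  - by rewrite addn0 mul0r adde0 /continuation integral0 adde0.
  - by move=> pol' _ _; rewrite addn0 /continuation integral0 adde0.
have [a' [v' [ma' mv' v'b gpol gpol']]] := IH t.+1.
pose u := next_value v' t.+1.
have mu : measurable_fun setT u.
  by apply: measurable_fun_ifT => //; exact: measurable_fun_ltr.
have ub w : 0 <= u w <= b.
  by rewrite /u /next_value; case: ifP => // _; rewrite rew0 rewle.
have mapol : measurable_fun setT (fun x : seq_space X => pol t (Defs.prefix x t)).
  by apply: measurableT_comp; [exact: mpol|exact: measurable_prefix].
have [s [ms sP]] := integral_near_optimal_selection P hA
  (measurable_alive_set t mpol) (measurable_wealth hphim mpol coordm t) mapol
  (bellman_measurable mu ub) (bellman_bounds mu ub) e0.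
(* Round [t] is played by the selector near-optimal for the Bellman value of the later rounds; the
   new value is the Bellman value along it. *)
exists (fun k => if k == t then s else a' k), (fun w => bellman u (w, s w)).
split.
- by move=> k; case: ifP.
- apply: measurableT_comp; first exact: bellman_measurable.
  exact: measurable_fun_pair.
- by move=> w; exact: bellman_bounds.
(* The later rounds lose [n * e] by induction; replacing the action of [pol] at [t] by [s] loses one
   more [e]. *)
- rewrite -addSnnS; apply: (le_trans gpol).
  rewrite (gainS _ mpol mv' v'b) (integral_next_wealth mu ub _ mpol).
  have -> : n.+1%:R * e = e + n%:R * e by rewrite -natr1 mulrDl mul1r addrC.
  rewrite EFinD [leRHS]addeA; apply: leeD2r; rewrite -[leRHS]addeA.
  exact: leeD2l.
- move=> pol' mpol' follow; rewrite -addSnnS gpol'//; last first.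
    move=> x k tk ak; rewrite follow// ?(ltnW tk)//.
    by rewrite gtn_eqF.
  rewrite (gainS _ mpol' mv' v'b) (integral_next_wealth mu ub _ mpol').
  apply: (congr1 (fun z => (gain pol' t + z)%E)); apply: eq_integral => x; rewrite inE => ax.
  by rewrite follow// eqxx.
Qed.

Let expected_reward pol :=
  (\int[P]_x (rew (rejection_time alpha (wealth phi pol x)))%:E)%E.

(** Truncated rewards increase to the full reward, so monotone convergence applies. *)
Lemma expected_reward_sup pol : is_policy pol ->
  expected_reward pol = ereal_sup (range (gain pol)).
Proof.
move=> mpol.
have mbk s : measurable_fun setT (fun x : seq_space X =>
    (banked alpha rew (wealth phi pol x) s)%:E).
  by apply/measurable_EFinP; exact: (measurable_banked alpha hphim mpol coordm rew s).
have bk0 x s : 0 <= banked alpha rew x s by case/andP: (banked_bounds alpha hrew x s).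
have nd (x : seq_space X) :
    nondecreasing_seq (fun s => (banked alpha rew (wealth phi pol x) s)%:E).
  by move=> s t st; rewrite lee_fin; exact: banked_nondecreasing.
have gnd : nondecreasing_seq (gain pol).
  move=> s t st; apply: ge0_le_integral => //; first by move=> x _; rewrite lee_fin.
  by move=> x _; exact: nd.
apply: (cvg_unique _ _ (ereal_nondecreasing_cvgn gnd)) => //.
rewrite /expected_reward.
rewrite (eq_integral (fun x : seq_space X =>
  limn (fun s => (banked alpha rew (wealth phi pol x) s)%:E))).
  by apply: cvg_monotone_convergence => // s x _; rewrite lee_fin.
by move=> x _; apply/esym/cvg_lim => //; exact: banked_cvg.
Qed.

Lemma expected_reward_le_markov pol (c : \bar R) : is_policy pol ->
  (forall a, (forall t, measurable_fun setT (a t)) ->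
    (\int[P]_x (rew (rejection_time alpha (markov_wealth phi alpha a x)))%:E <= c)%E) ->
  (expected_reward pol <= c)%E.
Proof.
move=> mpol hc; rewrite expected_reward_sup//.
apply: ge_ereal_sup => _ [n _ <-]; apply/lee_addgt0Pr => e e0.
have n0 : 0 < n.+1%:R :> R by rewrite ltr0n.
(* The [n] rounds lose [n * (e / n.+1) <= e] in all; [n.+1] allows the horizon [0]. *)
have en0 : 0 < e / n.+1%:R by rewrite divr_gt0.
have [a [v [ma mv vb gpol gpol']]] := backward_induction n 0 mpol en0.
have mmpol := markov_to_policy_is_policy alpha hphim ma.
have follow x s : (0 <= s)%N ->
    alive alpha (wealth phi (markov_to_policy phi alpha a) x) s ->
    markov_to_policy phi alpha a (Defs.prefix x s) =
    a s (wealth phi (markov_to_policy phi alpha a) x s).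
  move=> _ ax; rewrite markov_to_policy_prefix.
  by have [_ /(_ ax) ->] := alive_markov_to_policy phi a alpha1 x s.
have gmarkov := gpol' _ mmpol follow.
rewrite add0n in gpol gmarkov; apply: (le_trans gpol).
apply: leeD; last first.
  by rewrite lee_fin mulrCA ger_pMr// ler_pdivrMr// mul1r ler_nat.
(* Before the first round every policy has wealth [1] and nothing banked, so both sides agree by
   computation. *)
have -> : (gain pol 0 + continuation v pol 0 =
  gain (markov_to_policy phi alpha a) 0 +
  continuation v (markov_to_policy phi alpha a) 0)%E by [].
rewrite -gmarkov; apply: le_trans (hc a ma).
under [leRHS]eq_integral => x _ do
  rewrite -(rejection_time_markov_to_policy phi a alpha1).
rewrite -/(expected_reward _) expected_reward_sup//.
by apply: ereal_sup_ubound; exists n.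
Qed.
End dynamic_programming.

Theorem theorem1 (R : realType)
    (dX : measure_display) (X : measurableType dX)
    (hX : standard_borel R X)
    (P0 : set (probability X R)) (pi1 : probability X R)
    (hpi1 : forall pi, P0 pi -> exists2 B, measurable B & pi B <> pi1 B)
    (P : probability (seq_space X) R) (hP : infinite_product pi1 P)
    (alpha : R) (halpha : 0 < alpha < 1)
    (dA : measure_display) (A : measurableType dA)
    (hA : standard_borel R A)
    (phi : A * X -> R)
    (hphi0 : forall ax, 0 <= phi ax)
    (hphim : measurable_fun setT phi)
    (hphi1 : forall (a : A) (pi : probability X R), P0 pi ->
       (\int[pi]_(x in setT) (phi (a, x))%:E <= 1)%E)
    (rew : enat -> R) (hrew : reward_function rew) :
  ereal_sup
    [set 'E_P [fun x => rew (rejection_time alpha (wealth phi pol x))]%E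
    | pol in @is_policy dX dA X A]
  = ereal_sup
    [set 'E_P [fun x => rew (rejection_time alpha (markov_wealth phi alpha a x))]%E
    | a in @is_markov_policy R dA A alpha].
Proof.
apply/eqP; rewrite eq_le; apply/andP; split.
- apply: ge_ereal_sup => _ [pol mpol <-]; rewrite unlock.
  apply: (expected_reward_le_markov hP halpha hA hphim hrew mpol) => a ma.
  apply: ereal_sup_ubound; exists a => //.
  by move=> t; exact: measurable_funTS.
- apply: ge_ereal_sup => _ [a ma <-]; apply: ereal_sup_ubound.
  (* [a t] is measurable on the interval only; its extension by [point] is measurable everywhere and
     keeps the rejection time. *)
  pose a' t := (a t) \_ `[0, alpha^-1[.
  have ma' t : measurable_fun setT (a' t).
    by apply: (iffLR (measurable_restrictT _ _)) => //; exact: ma.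
  exists (markov_to_policy phi alpha a').
    exact: markov_to_policy_is_policy.
  rewrite unlock; apply: eq_integral => x _.
  rewrite (rejection_time_markov_to_policy phi a' halpha).
  congr (rew (rejection_time _ _))%:E.
  by apply/funext => t; exact: markov_wealth_restrict.
Qed.
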